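(* For any finite simple claw-free graph $G$ with no isolated vertex, $$\gamma_{\times 2}(G)\leq \gamma_t(G)+\gamma(G),$$ where $\gamma_{\times 2}(G)$ is the double domination number, $\gamma_t(G)$ the total domination number and $\gamma(G)$ the domination number of $G$.
   Context: Graphs are finite and simple. For a vertex $v\in V(G)$, the open neighbourhood is $N(v)=\{u\in V(G): u \text{ is adjacent to } v\}$ and the closed neighbourhood is $N[v]=N(v)\cup\{v\}$. A graph is claw-free if it does not contain the complete bipartite graph $K_{1,3}$ as an induced subgraph. A set $D\subseteq V(G)$ is a dominating set if $|D\cap N[v]|\ge 1$ for every $v\in V(G)$; the domination number $\gamma(G)$ is the minimum cardinality of a dominating set. A set $D\subseteq V(G)$ is a double dominating set (2-tuple dominating set) if $|D\cap N[v]|\ge 2$ for every $v\in V(G)$ (including the vertices of $D$); the double domination number $\gamma_{\times 2}(G)$ is the minimum cardinality of a double dominating set. In a graph $G$ with no isolated vertices, a total dominating set is a set $S\subseteq V(G)$ such that every vertex of $G$ (including the vertices of $S$) is adjacent to at least one vertex in $S$; the total domination number $\gamma_t(G)$ is the minimum cardinality of a total dominating set. *)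

(* Defs.v *)
From mathcomp Require Import all_boot.

Set Implicit Arguments.
Unset Strict Implicit.
Unset Printing Implicit Defensive.

(* A finite simple graph is a symmetric irreflexive relation e on a finType.  *)

Definition open_nbh (T : finType) (e : rel T) (v : T) : {set T} :=
  [set u | e v u].

Definition closed_nbh (T : finType) (e : rel T) (v : T) : {set T} :=
  v |: open_nbh e v.

Definition isolated (T : finType) (e : rel T) (v : T) : bool :=
  open_nbh e v == set0.

Definition complete_bipartite (m n : nat) : rel ('I_m + 'I_n) :=
  fun x y => match x, y with
             | inl _, inr _ | inr _, inl _ => true
             | _, _ => false
             end.

Definition has_induced_subgraph (T H : finType) (e : rel T) (h : rel H) : Prop :=
  exists f : H -> T, injective f /\ forall x y : H, e (f x) (f y) = h x y.

Definition claw_free (T : finType) (e : rel T) : Prop :=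
  ~ has_induced_subgraph e (@complete_bipartite 1 3).

Definition dominating (T : finType) (e : rel T) (D : {set T}) : bool :=
  [forall v, 1 <= #|D :&: closed_nbh e v|].

Definition double_dominating (T : finType) (e : rel T) (D : {set T}) : bool :=
  [forall v, 2 <= #|D :&: closed_nbh e v|].

Definition total_dominating (T : finType) (e : rel T) (S : {set T}) : bool :=
  [forall v, exists u in S, e v u].

(* The minimum is meaningful only when P holds of the full vertex set, as     *)
(* otherwise the value defaults to #|T|; the lemmas below show that this is   *)
(* so for the three domination predicates in graphs without isolated vertex.  *)
Definition min_card (T : finType) (P : pred {set T}) : nat :=
  #|[arg min_(D < [set: T] | P D) #|D| ]|.

Definition domination_number (T : finType) (e : rel T) : nat :=
  min_card (dominating e).

Definition double_domination_number (T : finType) (e : rel T) : nat :=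
  min_card (double_dominating e).

Definition total_domination_number (T : finType) (e : rel T) : nat :=
  min_card (total_dominating e).

Lemma min_cardP (T : finType) (P : pred {set T}) : P [set: T] ->
  (exists2 D, P D & #|D| = min_card P) /\
  (forall D, P D -> min_card P <= #|D|).
Proof.
by rewrite /min_card => PT; case: arg_minnP => // D PD minD; split; first exists D.
Qed.

Lemma dominating_setT (T : finType) (e : rel T) : dominating e [set: T].
Proof.
by apply/forallP => v; rewrite setTI; apply/card_gt0P; exists v; rewrite setU11.
Qed.

Lemma double_dominating_setT (T : finType) (e : rel T) :
  irreflexive e -> (forall v, ~~ isolated e v) -> double_dominating e [set: T].
Proof.
move=> irr iso; apply/forallP => v.
by rewrite setTI cardsU1 inE irr ltnS card_gt0; apply: iso.
Qed.

Lemma total_dominating_setT (T : finType) (e : rel T) :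
  (forall v, ~~ isolated e v) -> total_dominating e [set: T].
Proof.
move=> iso; apply/forallP => v; have /set0Pn[u] := iso v.
by rewrite inE => evu; apply/existsP; exists u; rewrite inE.
Qed.

(* Main.v *)
Require Import Defs.
From mathcomp Require Import all_boot.

Set Implicit Arguments.
Unset Strict Implicit.
Unset Printing Implicit Defensive.

(** Let S be a minimum total dominating set and D a minimum dominating set.
    The union U of S and D already meets every closed neighbourhood, and it can
    fail to meet N[v] twice only when N[v] meets U in a single vertex x, which
    then has to lie in both S and D.  For a fixed such x, the vertices v that
    fail form a clique: x has a neighbour y in S, and y is adjacent to none of
    them, so two nonadjacent ones would form with y a claw centred at x
    ([private_clique]).  A single one of these vertices, added to U, therefore
    repairs all of them at once.  One vertex is added for each x in the
    intersection of S and D, and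
    #|S :|: D| + #|S :&: D| = #|S| + #|D| ([exists_double_dominating]). *)

Section ClawFree.

Variables (T : finType) (e : rel T).
Hypotheses (e_sym : symmetric e) (e_irr : irreflexive e).

Lemma in_closed_nbh v u : (u \in closed_nbh e v) = (u == v) || e v u.
Proof. by rewrite !inE. Qed.

Lemma claw_free_adjacent x a b c : claw_free e ->
  e x a -> e x b -> e x c -> uniq [:: a; b; c] -> [|| e a b, e a c | e b c].
Proof.
move=> cf xa xb xc abc; apply/negPn/negP => /norP[ab /norP[ac bc]]; apply: cf.
pose leaf (i : 'I_3) := nth x [:: a; b; c] i.
have x_leaf i : e x (leaf i) by case: i => [[|[|[|]]]].
have leaf_leaf i j : e (leaf i) (leaf j) = false.
  by case: i j => [[|[|[|]]]//= ?] [[|[|[|]]]//= ?];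
     rewrite /leaf /= ?e_irr //; apply/negbTE; rewrite // e_sym.
exists (fun z => match z with inl _ => x | inr i => leaf i end); split.
  move=> [i|i] [j|j] /=; first by rewrite !ord1.
  - by move=> E; have := x_leaf j; rewrite -E e_irr.
  - by move=> E; have := x_leaf i; rewrite E e_irr.
  - by move/eqP; rewrite nth_uniq ?ltn_ord // => /eqP/ord_inj->.
by case=> [i|i] [j|j] /=; rewrite ?e_irr ?x_leaf ?leaf_leaf // e_sym x_leaf.
Qed.

(** Private neighbours in the closed sense: x itself is one exactly when it lies
    in U and has no neighbour there. *)
Definition private_nbh (U : {set T}) (x : T) : {set T} :=
  [set v | U :&: closed_nbh e v == [set x]].

Lemma private_nbhP (U : {set T}) x v u :
  v \in private_nbh U x -> u \in U -> u \in closed_nbh e v -> u = x.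
Proof.
by rewrite inE => /eqP E uU uv; apply/set1P; rewrite -E inE uU.
Qed.

Lemma private_nbh_closed (U : {set T}) x v :
  v \in private_nbh U x -> x \in closed_nbh e v.
Proof.
by rewrite inE => /eqP E; have := set11 x; rewrite -E inE => /andP[].
Qed.

(** The neighbour y of x in U also lies in N[x], so v cannot be x itself. *)
Lemma private_nbh_adjacent (U : {set T}) x y v : y \in U -> e x y ->
  v \in private_nbh U x -> e x v.
Proof.
move=> yU xy vP; have := private_nbh_closed vP.
rewrite in_closed_nbh e_sym => /orP[/eqP xv|//]; subst v.
have yx : y = x by apply: private_nbhP vP yU _; rewrite in_closed_nbh xy orbT.
by rewrite yx e_irr in xy.
Qed.

(** The neighbour y of x in U sees no private neighbour of x, hence serves as
    the third leaf of a claw centred at x. *)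
Lemma private_clique (U : {set T}) x y v w : claw_free e ->
    y \in U -> e x y ->
  v \in private_nbh U x -> w \in private_nbh U x -> w \in closed_nbh e v.
Proof.
move=> cf yU xy vP wP; rewrite in_closed_nbh.
have y_far z : z \in private_nbh U x -> y \notin closed_nbh e z.
  move=> zP; apply/negP => /(private_nbhP zP yU) yx.
  by rewrite yx e_irr in xy.
have [//|wv /=] := eqVneq w v.
have := y_far _ vP; have := y_far _ wP.
rewrite !in_closed_nbh => /norP[yw /negbTE wy] /norP[yv /negbTE vy].
have xv := private_nbh_adjacent yU xy vP.
have xw := private_nbh_adjacent yU xy wP.
have /= := claw_free_adjacent cf xy xv xw.
rewrite !inE negb_or yv yw eq_sym wv => /(_ isT).
by rewrite e_sym vy e_sym wy.
Qed.

(** U already meets N[v] twice unless v is a private neighbour of some x in both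
    S and D; then x and the vertex chosen to repair x are two distinct members
    of N[v]. *)
Lemma exists_double_dominating (S D : {set T}) : claw_free e ->
    total_dominating e S -> dominating e D ->
  exists2 W : {set T}, double_dominating e W & #|W| <= #|S| + #|D|.
Proof.
move=> cf /forallP Sdom /forallP Ddom; pose U := S :|: D.
(* When x has no private neighbour, the default x is already in U, so that
   nothing is added. *)
pose repair x := odflt x [pick v in private_nbh U x].
exists (U :|: [set repair x | x in S :&: D]); last first.
  rewrite -cardsUI; apply: leq_trans (leq_card_setU _ _) _.
  by rewrite leq_add2l leq_imset_card.
apply/forallP => v; have /card_gt0P[x] := Ddom v.
rewrite inE => /andP[xD xv].
have [U1|U2] := leqP #|U :&: closed_nbh e v| 1; last first.
  by apply: leq_trans U2 (subset_leq_card _); rewrite setSI ?subsetUl.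
have vP : v \in private_nbh U x.
  by rewrite inE eq_sym eqEcard cards1 U1 andbT sub1set inE xv andbT inE xD orbT.
have xS : x \in S.
  have /existsP[u /andP[uS vu]] := Sdom v.
  rewrite -(private_nbhP (u := u) vP) //; first by rewrite inE uS.
  by rewrite in_closed_nbh vu orbT.
have wP : repair x \in private_nbh U x.
  by rewrite /repair; case: pickP => [//|/(_ v)]; rewrite vP.
have /existsP[y /andP[yS xy]] := Sdom x.
have yU : y \in U by rewrite inE yS.
apply/card_gt1P; exists x, (repair x); split.
- by rewrite !inE xS -in_closed_nbh xv.
- rewrite inE (private_clique cf yU xy vP wP) andbT inE.
  by rewrite [X in _ || X]imset_f ?orbT // inE xS.
- apply/eqP => E; have := private_nbh_adjacent yU xy wP.
  by rewrite -E e_irr.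
Qed.

End ClawFree.

Theorem theorem2p10 (T : finType) (e : rel T)
    (e_sym : symmetric e) (e_irr : irreflexive e)
    (e_claw_free : claw_free e)
    (e_no_isolated : forall v : T, ~~ isolated e v) :
  double_domination_number e <=
    total_domination_number e + domination_number e.
Proof.
have [_ minW] := min_cardP (double_dominating_setT e_irr e_no_isolated).
have [[S Sdom Scard] _] := min_cardP (total_dominating_setT e_no_isolated).
have [[D Ddom Dcard] _] := min_cardP (dominating_setT e).
have [W Wdom] := exists_double_dominating e_sym e_irr e_claw_free Sdom Ddom.
by rewrite Scard Dcard => Wcard; apply: leq_trans (minW W Wdom) Wcard.
Qed.
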